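(* Let $d=2$ and let $\mathbb P=\frac12\delta_{\{(1,1)\}}+\frac12\delta_{\{(1,-1)\}}$ be the law on $\mathbb R^2$ putting mass $1/2$ at each of the points $(1,1)$ and $(1,-1)$. For $\delta\in(0,1/2)$ it holds that $$\sup_{\mathbb P':d_W(\mathbb P',\mathbb P)\le\delta}\ \inf_{\mathbf u\in\mathbb R^2:\|\mathbf u\|=1}\mathbb P'(\{\mathbf x:\langle\mathbf u,\mathbf x\rangle\ge0\})=\frac1{\sqrt2}\,\delta<\delta=D_\delta(\mathbf 0|\mathbb P).$$
   Context: $\delta_{\{\mathbf x\}}$ is the Dirac mass at $\mathbf x$, $\|\cdot\|$ the Euclidean norm, $\langle\cdot,\cdot\rangle$ the Euclidean inner product. For laws $\mathbb P,\mathbb P'$ on $\mathbb R^2$ the Wasserstein distance is $d_W(\mathbb P,\mathbb P')=\inf_\Pi\int\|\mathbf x-\mathbf y\|\,\Pi(\mathrm d\mathbf x,\mathrm d\mathbf y)\in[0,\infty]$, over all joint laws $\Pi$ with marginals $\mathbb P,\mathbb P'$. The robustified halfspace depth is $$D_\delta(\mathbf z|\mathbb P)=\inf_{\|\mathbf u\|=1}\ \sup_{\mathbb P':d_W(\mathbb P',\mathbb P)\le\delta}\mathbb P'(\{\mathbf x:\langle\mathbf u,\mathbf x-\mathbf z\rangle\ge0\}).$$ *)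

(* Defs.v *)
From HB Require Import structures.
From mathcomp Require Import all_boot all_order all_algebra.
From mathcomp Require Import all_classical all_reals all_analysis.

Set Implicit Arguments.
Unset Strict Implicit.
Unset Printing Implicit Defensive.

Import Order.TTheory GRing.Theory Num.Theory.

Local Open Scope classical_set_scope.
Local Open Scope ring_scope.
Local Open Scope ereal_scope.

(* R^2 with the product of the Borel sigma-algebras of R. The library's norm on
   a product type is the sup norm, hence the explicit Euclidean one below. *)
Notation plane R := (measurableTypeR R * measurableTypeR R)%type.

Section depth.
Context {R : realType}.
Implicit Types (x y z u : plane R) (P Q : probability (plane R) R).

Definition inner x y : R := (x.1 * y.1 + x.2 * y.2)%R.

Definition enorm x : R := Num.sqrt (inner x x).

Definition vsub x y : plane R := ((x.1 - y.1)%R, (x.2 - y.2)%R).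

Definition unit_circle : set (plane R) := [set u | enorm u = 1%R].

Definition coupling P Q : set (probability (plane R * plane R)%type R) :=
  [set Pi | forall A : set (plane R), measurable A ->
     pushforward Pi fst A = P A /\ pushforward Pi snd A = Q A].

Definition wasserstein P Q : \bar R :=
  ereal_inf [set \int[Pi]_p (enorm (vsub p.1 p.2))%:E | Pi in coupling P Q].

Definition wball P (delta : R) : set (probability (plane R) R) :=
  [set P' | wasserstein P' P <= delta%:E].

Definition halfspace u z : set (plane R) :=
  [set x | (0 <= inner u (vsub x z))%R].

Definition robust_depth (delta : R) z P : \bar R :=
  ereal_inf [set ereal_sup [set P' (halfspace u z) | P' in wball P delta]
            | u in unit_circle].

Definition two_point : set (plane R) -> \bar R :=
  measure_add
    (mscale (2^-1)%:nng%R (dirac ((1%R, 1%R) : plane R)))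
    (mscale (2^-1)%:nng%R (dirac ((1%R, (-1)%R) : plane R))).

HB.instance Definition _ := Measure.on two_point.

Let two_point_setT : two_point setT = 1.
Proof.
rewrite /two_point measure_addE /= /mscale /= !diracT !mule1 -EFinD.
by rewrite -[X in (X + _)%R]div1r -[X in (_ + X)%R]div1r -splitr.
Qed.

HB.instance Definition _ :=
  Measure_isProbability.Build _ _ R two_point two_point_setT.

End depth.

(* Main.v *)
(** Lower bounds: carrying mass m from an atom to a point a' costs at most
    m |a' - a|. Mass delta / sqrt 2 sent to the origin lies in every closed
    half-plane through the origin; and for a unit vector u, the atom (1, e) with e
    the sign of u.2 is carried by the unit translation u into the half-plane of u.

    Upper bounds are by Kantorovich duality: if c * sum_i 1_(H_i)(x) <= |x - y| for
    both atoms y, then c * sum_i P'(H_i) <= d_W(P', P). For the robustified depth a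
    single half-plane {x.1 <= 0} suffices. For the sup-inf, take the half-planes
    {x.1 <= t x.2}, with t in the interior of a uniform grid on [-1, 1] of mesh
    2 / (n + 1), and c = sqrt 2 / (n + 1): from (1, 1), reaching the line
    x.1 = s x.2 costs at least (1 - s) / sqrt (1 + s^2) >= (1 - s) / sqrt 2, and
    crossing it buys the grid points t >= s, at most (1 - s)(n + 1) / 2 of them.
    Hence a depth r satisfies sqrt 2 * n / (n + 1) * r <= delta for every n. *)

From HB Require Import structures.
Require Import Defs.
From mathcomp Require Import all_boot all_order all_algebra.
From mathcomp Require Import all_classical all_reals all_analysis.
From mathcomp Require Import measurable_realfun ring lra.
Import Order.TTheory GRing.Theory Num.Theory.
Local Open Scope classical_set_scope.
Local Open Scope ring_scope.

(** * Distances to the atoms versus counts of grid half-planes *)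

Section plane_geometry.
Context {R : realType}.
Implicit Types x : plane R.

Lemma inner_ge0 x : 0 <= inner x x.
Proof. by rewrite /inner addr_ge0// -expr2 sqr_ge0. Qed.

Lemma le_enorm (c : R) x : 0 <= c -> (c <= enorm x) = (c ^+ 2 <= inner x x).
Proof.
move=> c0; rewrite -[in RHS](sqr_sqrtr (inner_ge0 x)) ler_sqr//.
by rewrite nnegrE sqrtr_ge0.
Qed.

Lemma inner_vsub (a b c d : R) :
  inner (vsub (a, b) (c, d)) (vsub (a, b) (c, d)) = (a - c) ^+ 2 + (b - d) ^+ 2.
Proof. by rewrite !expr2. Qed.

(* The interior nodes of the uniform grid of mesh 2 / (n + 1) on [-1, 1], indexed by
   i < n; at i = n the value is the endpoint 1. *)
Definition slope (n : nat) (i : nat) : R := -1 + 2 * i.+1%:R / n.+1%:R.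

Lemma slope_itv n i : (i < n)%N -> -1 <= slope n i <= 1.
Proof.
move=> ltin; rewrite /slope.
have n0 : (0 : R) < n.+1%:R by rewrite ltr0n.
have h : (i.+1%:R : R) <= n.+1%:R by rewrite ler_nat ltnS ltnW.
have h1 : 0 <= 2 * i.+1%:R / n.+1%:R :> R by rewrite divr_ge0// mulr_ge0.
have h2 : 2 * i.+1%:R / n.+1%:R <= 2 :> R by rewrite ler_pdivrMr// ler_wpM2l.
by move: h1 h2; set q := _ / _ => h1 h2; apply/andP; split; lra.
Qed.

Lemma slope_rev n (i : 'I_n) : slope n (rev_ord i) = - slope n i.
Proof.
have n0 : (n%:R + 1 : R) != 0 by rewrite natr1 pnatr_eq0.
have e : ((rev_ord i).+1 = n - i)%N by rewrite /= subnSK.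
rewrite /slope e natrB 1?ltnW// -[i.+1%:R]natr1 -[n.+1%:R]natr1.
by field.
Qed.

(* The indicator is dominated by the increments of the piecewise linear function
   [fun tau => max 0 (tau - s)], so the sum telescopes. *)
Lemma sum_slope_ge n (s : R) : s <= 1 ->
  2 / n.+1%:R * (\sum_(i < n) (s <= slope n i)%R%:R) <= 1 - s.
Proof.
move=> s1.
pose g (i : nat) : R := Num.max 0 (slope n i - s).
have n0 : (0 : R) < n.+1%:R by rewrite ltr0n.
have slopeS i : slope n i.+1 = slope n i + 2 / n.+1%:R.
  by rewrite /slope -[i.+2%:R]natr1 mulrDr mulr1 mulrDl addrA.
have slopen : slope n n = 1 by rewrite /slope mulfK ?lt0r_neq0//; lra.
rewrite mulr_sumr -(big_mkord xpredT (fun i => 2 / n.+1%:R * (s <= slope n i)%R%:R)).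
apply: (@le_trans _ _ (\sum_(0 <= i < n) (g i.+1 - g i))).
  apply: ler_sum => i _; rewrite /g slopeS.
  have d0 : (0 : R) < 2 / n.+1%:R by rewrite divr_gt0.
  move: (2 / _) d0 => d d0; case: (leP s (slope n i)) => h; rewrite ?mulr1 ?mulr0.
    by rewrite !max_r ?subr_ge0//; lra.
  rewrite [X in _ - X]max_l; last lra.
  by rewrite subr0 le_max lexx.
rewrite telescope_sumr// /g slopen [X in X - _]max_r; last lra.
by rewrite lerBlDr lerDl le_max lexx.
Qed.

Lemma slope_count_top n (a b : R) :
  Num.sqrt 2 / n.+1%:R * (\sum_(i < n) (a <= slope n i * b)%R%:R) <=
  enorm (vsub (a, b) (1, 1)) :> R.
Proof.
have n0 : (0 : R) < n.+1%:R by rewrite ltr0n.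
have r0 : (0 : R) < Num.sqrt 2 by rewrite sqrtr_gt0.
have r2 : (Num.sqrt 2 : R) ^+ 2 = 2 by rewrite sqr_sqrtr.
(* Beyond the line a + b = 0 the distance to (1, 1) is at least sqrt 2, so the trivial count n < n +
   1 is enough. *)
have [ab0|ab0] := leP (a + b) 0.
  apply: (@le_trans _ _ (Num.sqrt 2)).
    rewrite mulrAC ler_pdivrMr// ler_pM2l//.
    apply: (@le_trans _ _ (\sum_(i < n) 1)).
      by apply: ler_sum => i _; rewrite (ler_nat R _ 1) leq_b1.
    by rewrite sumr_const card_ord ler_nat.
  rewrite le_enorm ?(ltW r0)// r2 inner_vsub.
  have := sqr_ge0 (a - b); nra.
(* Here |b| < a, so no slope in [-1, 1] satisfies a <= t * b and the count is zero. *)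
have [ba|ba] := ltP b a.
  rewrite big1 ?mulr0 ?sqrtr_ge0// => i _.
  have /andP[t1 t2] := @slope_itv n i (ltn_ord i).
  rewrite leNgt; suff -> : slope n i * b < a by [].
  by have [b0|b0] := leP 0 b; nra.
(* In the remaining case |a| <= b and b > 0: the point lies on the line of slope parameter s = a / b
   <= 1, and the grid points counted are those with t >= s. *)
have b0 : 0 < b by lra.
have sum1 : 2 / n.+1%:R * (\sum_(i < n) (a / b <= slope n i)%R%:R) <= 1 - a / b.
  by apply: sum_slope_ge; rewrite ler_pdivrMr// mul1r.
have -> : \sum_(i < n) (a <= slope n i * b)%R%:R =
    \sum_(i < n) (a / b <= slope n i)%R%:R :> R.
  by apply: eq_bigr => i _; rewrite ler_pdivrMr.
set S := \sum_(i < n) _ in sum1 *.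
(* Writing sqrt 2 as 2 / sqrt 2 brings out the left-hand side of [sum1]. *)
have -> : Num.sqrt 2 / n.+1%:R * S = 2 / n.+1%:R * S / Num.sqrt 2.
  by rewrite -[X in X / n.+1%:R * S / _]r2; field; rewrite !gt_eqF.
apply: (@le_trans _ _ ((b - a) / (Num.sqrt 2 * b))).
  rewrite invfM [X in _ <= _ * X]mulrC mulrA ler_pM2r ?invr_gt0//.
  by rewrite mulrBl divff ?gt_eqF.
rewrite le_enorm; last by rewrite divr_ge0 ?subr_ge0// ltW// mulr_gt0.
rewrite expr_div_n ler_pdivrMr ?exprn_gt0 ?mulr_gt0// exprMn r2 inner_vsub.
(* Cauchy-Schwarz with the vector (b, - a), of square norm at most 2 * b ^+ 2 *)
apply: (@le_trans _ _ (((a - 1) ^+ 2 + (b - 1) ^+ 2) * (a ^+ 2 + b ^+ 2))).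
  have := sqr_ge0 ((a - 1) * a + (b - 1) * b); lra.
apply: ler_wpM2l; first by rewrite addr_ge0// sqr_ge0.
have : a ^+ 2 <= b ^+ 2 by nra.
lra.
Qed.

(** The reflection b -> - b exchanges the two atoms, and the grid is symmetric about 0, so reversing
    the indices reduces this to [slope_count_top]. *)
Lemma slope_count_bottom n (a b : R) :
  Num.sqrt 2 / n.+1%:R * (\sum_(i < n) (a <= slope n i * b)%R%:R) <=
  enorm (vsub (a, b) (1, -1)) :> R.
Proof.
have := slope_count_top n a (- b).
rewrite (reindex_inj rev_ord_inj)/=.
under eq_bigr do rewrite slope_rev mulrNN.
suff -> : enorm (vsub (a, - b) (1, 1)) = enorm (vsub (a, b) (1, -1)) by [].
by congr Num.sqrt; rewrite !inner_vsub; ring.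
Qed.

End plane_geometry.

Local Open Scope ereal_scope.

(** * Measurability of the cost, of half-planes and of points *)

Section measurability.
Context {R : realType}.

Lemma measurable_enorm_vsub (D : set (plane R * plane R)) :
  measurable_fun D (fun p : plane R * plane R => (enorm (vsub p.1 p.2))%:E).
Proof.
apply/measurable_EFinP; apply: (measurable_funS measurableT) => //.
apply: (measurableT_comp (f := @Num.sqrt R)).
  by apply: continuous_measurable_fun; exact: sqrt_continuous.
rewrite /inner /vsub /=.
have m11 : measurable_fun setT (fun p : plane R * plane R => p.1.1 : R).
  exact: (measurableT_comp measurable_fst measurable_fst).
have m12 : measurable_fun setT (fun p : plane R * plane R => p.1.2 : R).
  exact: (measurableT_comp measurable_snd measurable_fst).
have m21 : measurable_fun setT (fun p : plane R * plane R => p.2.1 : R).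
  exact: (measurableT_comp measurable_fst measurable_snd).
have m22 : measurable_fun setT (fun p : plane R * plane R => p.2.2 : R).
  exact: (measurableT_comp measurable_snd measurable_snd).
by apply: measurable_funD; apply: measurable_funM; apply: measurable_funB.
Qed.

Lemma measurable_closed_halfplane (u : plane R) :
  measurable [set x : plane R | (0 <= inner u x)%R].
Proof.
rewrite -[X in measurable X]setTI.
have m : measurable_fun setT (fun x : plane R => inner u x : R).
  by apply: measurable_funD; apply: measurable_funM.
have -> : [set x : plane R | (0 <= inner u x)%R] =
    (fun x => inner u x) @^-1` `[0%R, +oo[%classic.
  by apply/seteqP; split => x /=; rewrite in_itv /= andbT.
exact: m.
Qed.

Lemma measurable_point (a : plane R) : measurable [set a].
Proof.
have -> : [set a] = [set a.1] `*` [set a.2].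
  by apply/seteqP; split => [x ->//|[x1 x2] [/= -> ->]]; case: a.
by apply: measurableX; exact: measurable_set1.
Qed.

End measurability.

(** * The easy half of Kantorovich duality *)

Section duality.
Context {R : realType}.

Definition upper_atom : plane R := (1%R, 1%R).
Definition lower_atom : plane R := (1%R, (-1)%R).

Lemma two_point_atoms : two_point (~` [set upper_atom; lower_atom]) = 0 :> \bar R.
Proof.
have notin a : [set upper_atom; lower_atom] a ->
    (a \in ~` [set upper_atom; lower_atom]) = false.
  by move=> ha; rewrite memNset// => /(_ ha).
rewrite /two_point measure_addE /= /mscale /= !diracE.
by rewrite !notin ?mule0 ?adde0//; [right|left].
Qed.

(** Integrate the pointwise bound against an arbitrary coupling: its first marginal turns the
    indicators into the masses [P (H i)]. A bound at the two atoms suffices, because the second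
    marginal concentrates the coupling on [D]. *)
Lemma wasserstein_dual (P : probability (plane R) R) n
    (H : 'I_n -> set (plane R)) (c : R) : (0 <= c)%R ->
  (forall i, measurable (H i)) ->
  (forall x y, [set upper_atom; lower_atom] y ->
     (c * (\sum_(i < n) \1_(H i) x) <= enorm (vsub x y))%R) ->
  c%:E * \sum_(i < n) P (H i) <= wasserstein P two_point.
Proof.
move=> c0 mH cH; apply: le_ereal_inf_tmp => _ [Pi cPi <-].
pose D : set (plane R * plane R) := snd @^-1` [set upper_atom; lower_atom].
have mA : measurable ([set upper_atom; lower_atom] : set (plane R)).
  by apply: measurableU; exact: measurable_point.
have mD : measurable D.
  by rewrite -[D]setTI; apply: measurable_snd.
have mfH i : measurable (fst @^-1` H i : set (plane R * plane R)).
  by rewrite -[X in measurable X]setTI; apply: measurable_fst.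
have PiD : Pi (~` D) = 0.
  have [_] := cPi (~` [set upper_atom; lower_atom]) (measurableC mA).
  by move=> h; apply: (etrans h); exact: two_point_atoms.
have PHD i : P (H i) = Pi (fst @^-1` H i `&` D).
  have [<- _] := cPi (H i) (mH i).
  rewrite /pushforward (measureDI _ _ mD)//= setDE.
  rewrite [X in X + _](_ : _ = 0) ?add0e//.
  apply/eqP; rewrite eq_le measure_ge0 andbT -PiD.
  by apply: measureIr => //; exact: measurableC.
apply: (@le_trans _ _ (\int[Pi]_(p in D) (enorm (vsub p.1 p.2))%:E)); last first.
  apply: ge0_subset_integral => //; first exact: measurable_enorm_vsub.
  by move=> p _; rewrite lee_fin sqrtr_ge0.
have mI i : measurable_fun D
    (fun p : plane R * plane R => (\1_(fst @^-1` H i) p : R)%:E).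
  by apply/measurable_EFinP/measurable_indic.
have I0 i (p : plane R * plane R) : 0 <= (\1_(fst @^-1` H i) p : R)%:E.
  by rewrite lee_fin.
under eq_bigr do rewrite PHD -integral_indic//.
rewrite -ge0_integral_sum//.
rewrite -ge0_integralZl//; [|exact: emeasurable_sum|by move=> p _; exact: sume_ge0].
apply: ge0_le_integral => //.
- by move=> p _; rewrite mule_ge0//; exact: sume_ge0.
- by apply: measurable_funeM; exact: emeasurable_sum.
- exact: measurable_enorm_vsub.
move=> [x y] /= Dy; rewrite sumEFin -EFinM lee_fin.
exact: cH.
Qed.

End duality.

(** * Moving part of the mass of one atom *)

Section mass_transfer.
Context {d} {T : measurableType d} {R : realType}.
Variables (k m : {nonneg R}%R) (x y z : T).

(** The mass 1/2 of one atom is split into k and m. The space [T] is left general so that the same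
    construction yields both the new law on the plane and its coupling with [two_point] on the
    product. *)
Definition three_point : set T -> \bar R :=
  measure_add (measure_add (mscale k (dirac x)) (mscale m (dirac y)))
              (mscale (2^-1)%:nng%R (dirac z)).

HB.instance Definition _ := Measure.on three_point.

Lemma three_pointE A : three_point A =
  k%:num%:E * dirac x A + m%:num%:E * dirac y A + (2^-1)%:E * dirac z A.
Proof. by rewrite /three_point measure_addE; congr (_ + _); exact: measure_addE. Qed.

Lemma integral_three_point (f : T -> R) : (forall t, 0 <= f t)%R ->
  measurable_fun setT f ->
  \int[three_point]_t (f t)%:E =
  (k%:num * f x + m%:num * f y + 2^-1 * f z)%:E.
Proof.
move=> f0 mf; have mf' : measurable_fun setT (EFin \o f) by exact/measurable_EFinP.
have f0' t : [set: T] t -> 0 <= (EFin \o f) t by rewrite lee_fin.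
rewrite !(ge0_integral_measure_add, ge0_integral_mscale)//.
by rewrite !integral_dirac// !diracT !mul1e.
Qed.

Hypothesis km : (k%:num + m%:num = 2^-1 :> R)%R.

Let three_pointT : three_point setT = 1.
Proof.
rewrite three_pointE !diracT !mule1 -!EFinD km.
by congr EFin; lra.
Qed.

Definition three_point_law : probability T R := HB.pack_for (probability T R)
  three_point (Measure_isProbability.Build _ _ R three_point three_pointT).

End mass_transfer.

Arguments three_point_law {d T R k m} x y z km.

Section depth_bounds.
Context {R : realType}.

Lemma mass_transfer (m e : R) (a' : plane R) :
  (0 <= m <= 2^-1)%R -> (e = 1 \/ e = -1)%R ->
  exists Q : probability (plane R) R,
    wasserstein Q two_point <= (m * enorm (vsub a' (1, e)))%:E /\
    forall A, A a' -> m%:E <= Q A.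
Proof.
move=> /andP[m0 m2] he.
have k0 : (0 <= 2^-1 - m)%R by rewrite subr_ge0.
pose k' := NngNum k0; pose m' := NngNum m0.
have km : (k'%:num + m'%:num = 2^-1 :> R)%R by rewrite /= subrK.
pose a : plane R := (1, e)%R; pose b : plane R := (1, - e)%R.
exists (three_point_law a a' b km); split; last first.
  move=> A Aa'.
  rewrite [leRHS]three_pointE [X in (_ + _ * X) + _]diracE mem_set// mule1.
  by apply: (le_trans (leeDr _ _) (leeDl _ _)); rewrite mule_ge0.
(* Only the mass m travels, from a to a'; the diagonal points (a, a) and (b, b) cost nothing. *)
pose Pi := three_point_law (a, a) (a', a) (b, b) km.
have cPi : coupling (three_point_law a a' b km) two_point Pi.
  move=> A mA; split.
    by rewrite /pushforward [LHS]three_pointE [RHS]three_pointE !diracE.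
  rewrite /pushforward [LHS]three_pointE -ge0_muleDl// -EFinD km.
  rewrite [RHS]measure_addE /= /mscale /=.
  (* For e = -1 the atoms appear in the opposite order. *)
  by rewrite !diracE /a /b; case: he => -> //; rewrite opprK addeC.
apply: (@le_trans _ _ (\int[Pi]_p (enorm (vsub p.1 p.2))%:E)).
  by apply: ereal_inf_lbound; exists Pi.
rewrite integral_three_point/=; last 2 first.
- by move=> t; exact: sqrtr_ge0.
- by apply/measurable_EFinP; exact: measurable_enorm_vsub.
have vsubxx (x : plane R) : enorm (vsub x x) = 0%R.
  by rewrite /enorm /inner /= !subrr mulr0 addr0 sqrtr0.
by rewrite !vsubxx !mulr0 add0r addr0.
Qed.

(** * Unit normals of half-planes through the origin *)

Lemma unit_circle_fst_ge (u : plane R) : unit_circle u ->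
  inner u u = 1%R /\ (- 1 <= u.1)%R.
Proof.
rewrite /unit_circle /= /enorm => u1.
have e : inner u u = 1%R by rewrite -[LHS]sqr_sqrtr ?inner_ge0// u1 expr1n.
split=> //; have [h|] := leP 0%R u.1; first by rewrite (le_trans _ h).
move: e; case: u {u1} => u v; rewrite /inner /=.
change ((u : R) * u + v * v = 1 -> (u : R) < 0 -> - 1 <= (u : R))%R => e u0.
nra.
Qed.

Definition slope_normal (t : R) : plane R :=
  (- (Num.sqrt (1 + t ^+ 2))^-1, t / Num.sqrt (1 + t ^+ 2))%R.

Lemma slope_normal_gt0 (t : R) : (0 < 1 + t ^+ 2)%R.
Proof. by rewrite ltr_pwDl// sqr_ge0. Qed.

Lemma unit_slope_normal (t : R) : unit_circle (slope_normal t).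
Proof.
rewrite /unit_circle /= /enorm -[RHS]sqrtr1; congr Num.sqrt.
rewrite /inner /slope_normal /=.
have s0 := slope_normal_gt0 t.
have r0 : (Num.sqrt (1 + t ^+ 2) != 0)%R by rewrite gt_eqF ?sqrtr_gt0.
rewrite mulrNN -!expr2 expr_div_n exprVn sqr_sqrtr ?ltW//.
by rewrite -[X in (X + _)%R]mul1r -mulrDl divff ?gt_eqF.
Qed.

Lemma slope_normal_halfplane (t : R) (x : plane R) :
  (0 <= inner (slope_normal t) x)%R = (x.1 <= t * x.2)%R.
Proof.
case: x => a b; rewrite /inner /slope_normal /=.
have s0 : (0 < Num.sqrt (1 + t ^+ 2))%R by rewrite sqrtr_gt0 slope_normal_gt0.
rewrite mulNr addrC subr_ge0 mulrAC [X in (X <= _)%R]mulrC.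
by rewrite ler_pM2r ?invr_gt0.
Qed.

Lemma indic_slope_halfplane (t a b : R) :
  \1_([set x : plane R | (0 <= inner (slope_normal t) x)%R]) (a, b) =
  ((a <= t * b)%R%:R : R).
Proof.
rewrite indicE -(slope_normal_halfplane t (a, b)); congr (nat_of_bool _)%:R%R.
by apply/idP/idP => [/set_mem//|h]; exact: mem_set.
Qed.

(** * The sup-inf over the Wasserstein ball *)

Definition halfplane_depth (P : probability (plane R) R) : \bar R :=
  ereal_inf [set P [set x : plane R | (0 <= inner u x)%R] | u in unit_circle].

(** Finiteness allows the depth to be replaced by a real r, so that the upper bound becomes real
    arithmetic. *)
Lemma halfplane_depth_fin_num (P : probability (plane R) R) :
  halfplane_depth P \is a fin_num.
Proof.
rewrite ge0_fin_numE; last first.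
  by apply: le_ereal_inf_tmp => _ [u _ <-]; exact: measure_ge0.
apply: (@le_lt_trans _ _ 1); last exact: ltry.
apply: (@le_trans _ _ (P [set x | (0 <= inner (slope_normal 0) x)%R])).
  by apply: ereal_inf_lbound; exists (slope_normal 0) => //; exact: unit_slope_normal.
by apply: probability_le1; exact: measurable_closed_halfplane.
Qed.

Lemma halfplane_depth_le (P : probability (plane R) R) (delta : R) :
  wball two_point delta P ->
  halfplane_depth P <= ((Num.sqrt 2)^-1 * delta)%:E.
Proof.
rewrite /wball /= => Pdelta.
have := halfplane_depth_fin_num P.
case E : (halfplane_depth P) => [r| |]// _; rewrite lee_fin.
have r0 : (0 < Num.sqrt 2 :> R)%R by rewrite sqrtr_gt0.
rewrite ler_pdivlMl//.
pose H (n : nat) (i : 'I_n) : set (plane R) :=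
  [set x | (0 <= inner (slope_normal (slope n i)) x)%R].
(* Each of the n half-planes of the grid has mass at least r; duality bounds the sum of these
   masses. *)
have bound n : (Num.sqrt 2 / n.+1%:R * (n%:R * r) <= delta)%R.
  have c0 : (0 <= Num.sqrt 2 / n.+1%:R :> R)%R by rewrite divr_ge0// ltW.
  rewrite -lee_fin; apply: le_trans Pdelta.
  apply: (@le_trans _ _ ((Num.sqrt 2 / n.+1%:R)%:E * \sum_(i < n) P (H n i))).
    rewrite EFinM lee_wpmul2l// mulr_natl.
    have -> : (r *+ n)%:E = \sum_(i < n) r%:E.
      by rewrite sumEFin sumr_const card_ord.
    apply: lee_sum => i _; rewrite -E; apply: ereal_inf_lbound.
    by exists (slope_normal (slope n i)) => //; exact: unit_slope_normal.
  apply: wasserstein_dual => // [i|[a b] y].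
    exact: measurable_closed_halfplane.
  have -> : (\sum_(i < n) \1_(H n i) (a, b) =
      \sum_(i < n) (a <= slope n i * b)%R%:R :> R)%R.
    by apply: eq_bigr => i _; exact: indic_slope_halfplane.
  by case=> ->; [exact: slope_count_top|exact: slope_count_bottom].
(* The limit in n is taken by the Archimedean property: if sqrt 2 * r > delta, any n > delta / (sqrt
   2 * r - delta) contradicts [bound n]. *)
rewrite leNgt; apply/negP => h.
have h0 : (0 < Num.sqrt 2 * r - delta)%R by rewrite subr_gt0.
(* The empty grid n = 0 already gives 0 <= delta. *)
have d0 : (0 <= delta)%R by have := bound 0%N; rewrite mul0r mulr0.
have /archi_boundP : (0 <= delta / (Num.sqrt 2 * r - delta))%R.
  by rewrite divr_ge0// ltW.
move: (bound (Num.bound (delta / (Num.sqrt 2 * r - delta)))).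
move: (Num.bound _) => n.
rewrite mulrAC ler_pdivrMr ?ltr0n// -[n.+1%:R%R]natr1 ltr_pdivrMr//.
move: (n%:R)%R (Num.sqrt 2)%R => N q; lra.
Qed.

Lemma halfplane_depth_ge (delta : R) : (0 < delta < 2^-1)%R ->
  exists2 P, wball two_point delta P &
    ((Num.sqrt 2)^-1 * delta)%:E <= halfplane_depth P.
Proof.
move=> /andP[d0 d2].
have r0 : (0 < Num.sqrt 2 :> R)%R by rewrite sqrtr_gt0.
have r1 : (1 <= Num.sqrt 2 :> R)%R by rewrite -[leLHS]sqrtr1 ler_sqrt// ler1n.
have m01 : (0 <= (Num.sqrt 2)^-1 * delta <= 2^-1)%R.
  apply/andP; split; first by rewrite mulr_ge0 ?invr_ge0 ?ltW.
  by rewrite ler_pdivrMl// (le_trans (ltW d2))// ler_peMl.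
(* The origin is at distance sqrt 2 from (1, 1), so this transfer costs exactly delta. *)
have [P [PW PA]] := mass_transfer _ 1 (0, 0)%R m01 (or_introl erefl).
exists P.
  apply: (le_trans PW); rewrite lee_fin.
  have -> : enorm (vsub (0, 0) (1, 1))%R = Num.sqrt 2 :> R.
    by congr Num.sqrt; rewrite inner_vsub; ring.
  by rewrite mulrC mulVKf ?gt_eqF.
apply: le_ereal_inf_tmp => _ [u _ <-]; apply: PA => /=.
by rewrite /inner /= !mulr0 addr0.
Qed.

(** * The robustified depth at the origin *)

Lemma robust_depth_le (delta : R) :
  robust_depth delta (0, 0)%R two_point <= delta%:E.
Proof.
apply: (@le_trans _ _ (ereal_sup [set (P' : probability (plane R) R)
    (halfspace (slope_normal 0) (0, 0)%R) | P' in wball two_point delta])).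
  by apply: ereal_inf_lbound; exists (slope_normal 0) => //; exact: unit_slope_normal.
apply: ge_ereal_sup => _ [P PW <-]; apply: le_trans PW.
pose H (i : 'I_1) : set (plane R) := halfspace (slope_normal 0) (0, 0)%R.
have HE : H ord0 = [set x | (0 <= inner (slope_normal 0) x)%R].
  by apply/seteqP; split => -[a b]; rewrite /H /halfspace /= /vsub /= !subr0.
have := @wasserstein_dual R P 1 H 1%R ler01.
rewrite big_ord_recl big_ord0 adde0 mul1e; apply.
  by move=> i; rewrite (ord1 i) HE; exact: measurable_closed_halfplane.
move=> [a b] y hy; rewrite mul1r big_ord_recl big_ord0 addr0 HE.
rewrite indic_slope_halfplane mul0r.
have [a0|_] := leP a 0%R; last by rewrite sqrtr_ge0.
(* Both atoms have first coordinate 1, so each is at distance at least 1 from the half-plane x.1 <=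
   0. *)
have [e ->] : exists e : R, y = (1, e)%R by case: hy => ->; eexists.
change (1 <= enorm (vsub (a, b) (1%R, e)))%R.
rewrite le_enorm// expr1n inner_vsub.
suff : (1 <= ((a : R) - 1) ^+ 2)%R by move/le_trans; apply; rewrite lerDl sqr_ge0.
by have {}a0 : ((a : R) <= 0)%R := a0; nra.
Qed.

Lemma robust_depth_ge (delta : R) : (0 < delta < 2^-1)%R ->
  delta%:E <= robust_depth delta (0, 0)%R two_point.
Proof.
move=> /andP[d0 d2]; apply: le_ereal_inf_tmp => _ [u uC <-].
have [uu u1] := @unit_circle_fst_ge u uC.
have [e he ue] : exists2 e : R, (e = 1 \/ e = -1)%R & (0 <= u.2 * e)%R.
  have [h|h] := leP 0%R u.2; [exists 1%R|exists (-1)%R]; [by left| |by right|].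
    by rewrite mulr1.
  by rewrite mulrN1 oppr_ge0 ltW.
have dI : (0 <= delta <= 2^-1)%R by rewrite !ltW.
have [P [PW PA]] := mass_transfer delta e (1 + u.1, e + u.2)%R dI he.
apply: (@le_trans _ _ (P (halfspace u (0, 0)%R))); last first.
  apply: ereal_sup_ubound; exists P => //; apply: (le_trans PW).
  rewrite (_ : enorm _ = 1%R) ?mulr1// -[RHS]uC; congr Num.sqrt.
  by rewrite /inner /= !(addrC _ u.1) !(addrC _ u.2) !addrK.
apply: PA; rewrite /halfspace /inner /vsub /= !subr0.
(* Since u is a unit vector, its inner product with (1, e) + u is 1 + u.1 + e * u.2, which is
   nonnegative by u.1 >= -1 and the choice of e. *)
move: uu u1 ue; rewrite /inner; case: u {uC PW} => u v /=.
change (((u : R) * u + (v : R) * v = 1 -> - 1 <= (u : R) ->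
  0 <= (v : R) * e -> 0 <= (u : R) * (1 + u) + (v : R) * (e + v)))%R.
lra.
Qed.

End depth_bounds.

Theorem lemma10 (R : realType) (delta : R) (hdelta : (0 < delta < 2^-1)%R) :
  let P : probability (plane R) R := two_point in
  [/\ ereal_sup
        [set ereal_inf
           [set (P' : probability (plane R) R)
                  [set x : plane R | (0 <= inner u x)%R] | u in unit_circle]
        | P' in wball P delta]
      = ((Num.sqrt 2)^-1 * delta)%:E,
      ((Num.sqrt 2)^-1 * delta)%:E < delta%:E
    & delta%:E = robust_depth delta (0%R, 0%R) P].
Proof.
move=> P; have /andP[d0 _] := hdelta; split.
- apply/eqP; rewrite eq_le; apply/andP; split.
    by apply: ge_ereal_sup => _ [P' P'W <-]; exact: halfplane_depth_le.
  have [P' P'W /le_trans] := @halfplane_depth_ge R delta hdelta; apply.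
  by apply: ereal_sup_ubound; exists P'.
- rewrite lte_fin gtr_pMl// invf_lt1 ?sqrtr_gt0//.
  by rewrite -[ltLHS]sqrtr1 ltr_sqrt// ltr1n.
- apply/eqP; rewrite eq_le robust_depth_le andbT.
  exact: robust_depth_ge.
Qed.
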